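(* For each $\theta\in\Theta$ define the asymptotic slope $$\Gamma(\theta):=\max_{1\le i\le n}\ \limsup_{c(\xi_i,z)\to\infty}\frac{\ell(\theta,z)-\ell(\theta,\xi_i)}{c(\xi_i,z)}.$$ Then every minimizer $(\theta^\star,\lambda^\star)$ of $F$ on $\Theta\times[0,\infty)$ satisfies $\lambda^\star\ge\Gamma(\theta^\star)$. In particular, if $\Gamma(\theta)>0$ for all $\theta\in\Theta$, there exists $\lambda_{\min}>0$ such that $$\min_{\Theta\times[0,\infty)}F=\min_{\Theta\times[\lambda_{\min},\infty)}F.$$
   Context: $\mathcal Z$ is a Polish space, $\Theta\subset\mathbb R^p$ is compact and convex, $\ell:\Theta\times\mathcal Z\to\mathbb R$ is a loss function, $c:\mathcal Z\times\mathcal Z\to[0,\infty)$ a cost function, $\rho>0$, and $\xi_1,\dots,\xi_n\in\mathcal Z$ are data points. For $(\theta,\lambda)\in\Theta\times[0,\infty)$, $$F(\theta,\lambda)=\frac1n\sum_{i=1}^n\sup_{z\in\mathcal Z}\big\{\ell(\theta,z)+\lambda(\rho-c(\xi_i,z))\big\}\in(-\infty,+\infty].$$ Here $\limsup_{c(\xi_i,z)\to\infty}g(z):=\lim_{R\to\infty}\sup\{g(z):z\in\mathcal Z,\ c(\xi_i,z)\ge R\}$, with $\sup\emptyset=-\infty$. A minimizer of $F$ is a point at which $F$ attains a finite minimum value; the use of $\min$ presupposes that $F$ has a minimizer on $\Theta\times[0,\infty)$. *)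

(* Defs.v *)
From HB Require Import structures.
From mathcomp Require Import all_boot all_order all_algebra.
From mathcomp Require Import all_classical all_reals all_analysis.

Set Implicit Arguments.
Unset Strict Implicit.
Unset Printing Implicit Defensive.

Import Order.TTheory GRing.Theory Num.Theory.
Import numFieldNormedType.Exports.

Local Open Scope classical_set_scope.
Local Open Scope ring_scope.

Record is_metric (R : realType) (T : Type) (d : T -> T -> R) : Prop := {
  dist_ge0 : forall x y, 0 <= d x y;
  dist_eq0 : forall x y, d x y = 0 <-> x = y;
  dist_sym : forall x y, d x y = d y x;
  dist_triangle : forall x y z, d x z <= d x y + d y z }.

(* The metric is existentially quantified: being Polish is a property of the
   topology. *)
Definition polish_space (R : realType) (T : topologicalType) : Prop :=
  (exists d : T -> T -> R,
    [/\ is_metric d,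
        (forall (x : T) (A : set T),
          nbhs x A <-> exists2 e : R, 0 < e & [set y | d x y < e] `<=` A) &
        (forall u : nat -> T,
          (forall e : R, 0 < e -> exists N : nat, forall i j : nat,
            (N <= i)%N -> (N <= j)%N -> d (u i) (u j) < e) ->
          exists l : T, u @ \oo --> l)]) /\
  (exists2 D : set T, countable D & dense D).

(* The supremum below is nonincreasing in [r], so the limit exists in [\bar R];
   it is -oo when [h] is bounded, since [ereal_sup set0 = -oo]. *)
Definition limsup_at_infinity (R : realType) (T : Type) (h g : T -> R)
    : \bar R :=
  lim (ereal_sup [set (g z)%:E | z in [set z | r <= h z]] @[r --> +oo]).

Section DualObjective.
Variables (R : realType) (p n : nat) (Z : Type).
Variables (l : 'rV[R]_p -> Z -> R) (c : Z -> Z -> R) (xi : 'I_n -> Z).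

Definition dual_objective (rho : R) (x : 'rV[R]_p * R) : \bar R :=
  ((n%:R^-1)%:E *
   \sum_(i < n) ereal_sup
     [set (l x.1 z + x.2 * (rho - c (xi i) z))%:E | z in [set: Z]])%E.

(* [-oo] is neutral for [maxe], so this is the true maximum as soon as
   [0 < n]. *)
Definition asymptotic_slope (theta : 'rV[R]_p) : \bar R :=
  (\big[maxe/-oo]_(i < n)
    limsup_at_infinity (c (xi i))
      (fun z => ((l theta z - l theta (xi i)) / c (xi i) z)%R))%E.

End DualObjective.

Definition is_minimizer (R : realType) (X : Type) (F : X -> \bar R)
    (D : set X) (x : X) : Prop :=
  [/\ D x, F x \is a fin_num & forall y, D y -> (F x <= F y)%E].

(* [min_D F] exists and equals [m]. *)
Definition is_min (R : realType) (X : Type) (F : X -> \bar R)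
    (D : set X) (m : \bar R) : Prop :=
  exists2 x, is_minimizer F D x & F x = m.

(* Main.v *)
(* If F(theta, lambda) is finite then so is each of its n suprema, which means
   that l(theta, z) <= lambda c(xi_i, z) + K_i for all z; dividing by c(xi_i, z)
   and letting it tend to infinity gives Gamma(theta) <= lambda.  For the second
   claim, the lambda-coordinate of any one minimizer serves as lambda_min. *)
Require Import Defs.
From HB Require Import structures.
From mathcomp Require Import all_boot all_order all_algebra.
From mathcomp Require Import all_classical all_reals all_analysis.
From mathcomp Require Import lra.

Import Order.TTheory GRing.Theory Num.Theory.
Import numFieldNormedType.Exports.

Local Open Scope classical_set_scope.
Local Open Scope ring_scope.

Set Implicit Arguments.
Unset Strict Implicit.

(** A nonincreasing extended-real function tends at [+oo] to its infimum, so every single threshold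
    [r] already gives an upper bound. *)
Lemma limsup_at_infinity_le_sup (R : realType) (T : Type) (h g : T -> R)
    (r : R) :
  (limsup_at_infinity h g <=
   ereal_sup [set (g z)%:E | z in [set z | (r <= h z)%R]])%E.
Proof.
rewrite /limsup_at_infinity (cvg_lim _ (@nonincreasing_cvge R _ _)) //.
- by apply: ereal_inf_lbound; exists r.
- move=> s t st; apply: le_ereal_sup => _ [z /= tz <-].
  by exists z => //=; exact: le_trans st tz.
Qed.

Lemma limsup_at_infinity_affine (R : realType) (T : Type) (h f : T -> R)
    (a K : R) :
  (forall z, f z <= a * h z + K) ->
  (limsup_at_infinity h (fun z => (f z / h z)%R) <= a%:E)%E.
Proof.
move=> fle; apply/lee_addgt0Pr => e e0.
(* Beyond this threshold [K <= e * h z], so the constant costs at most [e] in the quotient; the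
   [+ 1] keeps the threshold positive when [K = 0], so that [h z > 0]. *)
have r0 : 0 < (`|K| + 1) / e by rewrite divr_gt0// ltr_wpDl.
apply: le_trans (limsup_at_infinity_le_sup _ _ ((`|K| + 1) / e)) _.
apply: ge_ereal_sup => _ [z /= rz <-].
have hz0 : 0 < h z by exact: lt_le_trans r0 rz.
rewrite -EFinD lee_fin ler_pdivrMr//.
move: rz; rewrite ler_pdivrMr// => rz.
by have := fle z; have := ler_norm K; rewrite mulrDl; lra.
Qed.

(** Infinities of opposite sign do not cancel in [\bar R], so one infinite summand makes the whole
    sum infinite. *)
Lemma dual_objective_fin_num (R : realType) (p n : nat) (Z : Type)
    (l : 'rV[R]_p -> Z -> R) (c : Z -> Z -> R) (rho : R) (xi : 'I_n -> Z)
    (x : 'rV[R]_p * R) :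
  (0 < n)%N -> dual_objective l c xi rho x \is a fin_num ->
  forall i, ereal_sup
    [set (l x.1 z + x.2 * (rho - c (xi i) z))%:E | z in [set: Z]]
      \is a fin_num.
Proof.
move=> n0 Ffin i.
have ninv0 : (0 < (n%:R^-1 : R)%:E)%E by rewrite lte_fin invr_gt0 ltr0n.
have /sum_fin_numP : (\sum_(i < n) ereal_sup
    [set (l x.1 z + x.2 * (rho - c (xi i) z))%:E | z in [set: Z]])%E
      \is a fin_num.
  move: Ffin; rewrite /dual_objective.
  (* The factor [n^-1] is positive, so an infinite sum would stay infinite after scaling. *)
  by case: (\sum_(i < n) _)%E => //; rewrite ?gt0_muley ?gt0_muleNy.
by apply => //; exact: mem_index_enum.
Qed.

Lemma asymptotic_slope_le (R : realType) (p n : nat) (Z : Type)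
    (l : 'rV[R]_p -> Z -> R) (c : Z -> Z -> R) (rho : R) (xi : 'I_n -> Z)
    (theta : 'rV[R]_p) (lambda : R) :
  (0 < n)%N -> dual_objective l c xi rho (theta, lambda) \is a fin_num ->
  (asymptotic_slope l c xi theta <= lambda%:E)%E.
Proof.
move=> n0 Ffin; apply: bigmax_le => [|i _]; first exact: leNye.
have Mfin := dual_objective_fin_num n0 Ffin i.
set M := ereal_sup _ in Mfin.
(* This constant is what remains when [l theta z + lambda * (rho - c (xi i) z) <= fine M] is solved
   for [l theta z - l theta (xi i)]. *)
apply: (@limsup_at_infinity_affine _ _ _ _ _
  (fine M - lambda * rho - l theta (xi i))) => z.
have : (l theta z + lambda * (rho - c (xi i) z) <= fine M)%R.
  by rewrite -lee_fin fineK//; apply: ereal_sup_ubound; exists z.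
by lra.
Qed.

Theorem proposition2p1 (R : realType) (p n : nat) (Z : topologicalType)
    (Theta : set 'rV[R]_p) (l : 'rV[R]_p -> Z -> R) (c : Z -> Z -> R)
    (rho : R) (xi : 'I_n -> Z)
    (Z_polish : polish_space R Z)
    (Theta_compact : compact Theta)
    (Theta_convex : convex_set Theta)
    (c_ge0 : forall z z' : Z, 0 <= c z z')
    (rho_gt0 : 0 < rho)
    (n_gt0 : (0 < n)%N) :
  let F := dual_objective l c xi rho in
  let Gamma := asymptotic_slope l c xi in
  (forall (theta : 'rV[R]_p) (lambda : R),
    is_minimizer F (Theta `*` `[0, +oo[) (theta, lambda) ->
    (Gamma theta <= lambda%:E)%E) /\
  ((exists x, is_minimizer F (Theta `*` `[0, +oo[) x) ->
   (forall theta, Theta theta -> (0 < Gamma theta)%E) ->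
   exists2 lambda_min : R, 0 < lambda_min &
     exists m : \bar R,
       is_min F (Theta `*` `[0, +oo[) m /\
       is_min F (Theta `*` `[lambda_min, +oo[) m).
Proof.
move=> F Gamma.
have slope_le theta lambda :
    is_minimizer F (Theta `*` `[0, +oo[) (theta, lambda) ->
    (Gamma theta <= lambda%:E)%E.
  by case=> _ Ffin _; exact: asymptotic_slope_le n_gt0 Ffin.
split=> // -[[theta lambda] xmin] Gamma0.
have [[/= thetaT _] Ffin Fle] := xmin.
have lambda0 : 0 < lambda.
  rewrite -lte_fin; exact: lt_le_trans (Gamma0 _ thetaT) (slope_le _ _ xmin).
exists lambda => //; exists (F (theta, lambda)).
split; exists (theta, lambda) => //.
(* The point lies on the edge of the smaller domain, which is contained in the original one because
   [lambda > 0]; minimality is inherited. *)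
split=> // [|y [yT /= ylambda]].
  by split => //=; rewrite in_itv/= lexx.
apply: Fle; split => //=; move: ylambda; rewrite !in_itv/= !andbT.
exact: le_trans (ltW lambda0).
Qed.
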